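(* Let $\mathcal{H}=(X;\tau_0,\tau_1,\tau_2)$ be a hypermap and let $M(\mathcal{H})=(Y;\mu_0,\mu_1,\mu_2)$ be its medial map in the $\tau$-model. Then $M(\mathcal{H})$ is a map; that is, it is a hypermap in which every $\langle\mu_0,\mu_2\rangle$-orbit contains exactly four flags. Its cells correspond naturally to the data of $\mathcal{H}$ as follows: (1) each hyperedge $e\in X/\langle\tau_0,\tau_2\rangle$ corresponds to a medial vertex $v_e=e\times\{\mathsf b,\mathsf w\}$, giving a bijection from hyperedges of $\mathcal{H}$ to vertices of $M(\mathcal{H})$; (2) each flag $x\in e$ corresponds to a half-edge $\{(x,\mathsf b),(x,\mathsf w)\}$ of $M(\mathcal{H})$ at $v_e$ labelled by $x$, giving a bijection from $X$ to the half-edges of $M(\mathcal{H})$, under which the half-edges at $v_e$ are exactly those labelled by elements of $e$; (3) each pair $\{x,\tau_1x\}$ corresponds to a medial edge $\{x,\tau_1x\}\times\{\mathsf b,\mathsf w\}$, giving a bijection from $\tau_1$-transpositions to edges of $M(\mathcal{H})$; (4) the elements of $X/\langle\tau_1,\tau_2\rangle$ (vertices of $\mathcal{H}$) correspond bijectively to the black faces of $M(\mathcal{H})$, via $u\mapsto u\times\{\mathsf b\}$; (5) the elements of $X/\langle\tau_1,\tau_0\rangle$ (faces of $\mathcal{H}$) correspond bijectively to the white faces of $M(\mathcal{H})$, via $f\mapsto f\times\{\mathsf w\}$. In particular, if $e$ has valence $k$, then $v_e$ has degree $2k$. At $v_e$, the black angles project (to the first coordinate) to the pairs $\{x,\tau_2x\}$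 and the white angles to the pairs $\{x,\tau_0x\}$, $x\in e$. Thus $M(\mathcal{H})$ has the canonical checkerboard colouring: every face is either black or white, and each edge has a black face on one side and a white face on the other.
   Context: A hypermap is a triple $\mathcal{H}=(X;\tau_0,\tau_1,\tau_2)$ where $X$ is a finite set (of flags), each $\tau_i$ is a fixed-point-free involution on $X$, and $\langle\tau_0,\tau_1,\tau_2\rangle$ acts transitively on $X$. Its vertices, (hyper)edges and faces are the orbits in $X/\langle\tau_1,\tau_2\rangle$, $X/\langle\tau_0,\tau_2\rangle$ and $X/\langle\tau_0,\tau_1\rangle$, respectively. The valence of a hyperedge $e$ is $|e|/2$. A map is a hypermap in which every $\langle\tau_0,\tau_2\rangle$-orbit has exactly four flags. Medial map in the $\tau$-model: let $\mathsf b,\mathsf w$ be two symbols (black, white), and let $\bar c$ denote the symbol different from $c\in\{\mathsf b,\mathsf w\}$. Put $Y=X\times\{\mathsf b,\mathsf w\}$, and define $M(\mathcal{H})=(Y;\mu_0,\mu_1,\mu_2)$ by $$\mu_0(x,c)=(\tau_1x,c),\quad \mu_2(x,c)=(x,\bar c),\quad \mu_1(x,\mathsf b)=(\tau_2x,\mathsf b),\quad \mu_1(x,\mathsf w)=(\tau_0x,\mathsf w).$$ For $M(\mathcal{H})$: vertices (medial vertices) are $\langle\mu_1,\mu_2\rangle$-orbits, edges (medial edges) are $\langle\mu_0,\mu_2\rangle$-orbits, faces are $\langle\mu_0,\mu_1\rangle$-orbits, half-edges are $\langle\mu_2\rangle$-orbits, and angles are $\langle\mu_1\rangle$-orbits.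 A half-edge or angle is at the vertex that contains it. The degree of a vertex is the number of half-edges at it. A face or angle is black if it is contained in $X\times\{\mathsf b\}$ and white if it is contained in $X\times\{\mathsf w\}$. *)

(* Defs.v *)
From HB Require Import structures.
From mathcomp Require Import all_boot all_order all_fingroup.
Set Implicit Arguments.
Unset Strict Implicit.
Unset Printing Implicit Defensive.

Local Open Scope group_scope.

Record flag_system (X : finType) := FlagSystem {
  inv0 : {perm X};
  inv1 : {perm X};
  inv2 : {perm X}
}.

Definition fpf_involution (X : finType) (s : {perm X}) : Prop :=
  forall x : X, s (s x) = x /\ s x != x.

(* Transitivity is the library's notion: there is exactly one orbit, so that
   the set of flags is nonempty. *)
Definition is_hypermap (X : finType) (H : flag_system X) : Prop :=
  [/\ fpf_involution (inv0 H), fpf_involution (inv1 H),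
      fpf_involution (inv2 H)
    & [transitive <<[set inv0 H; inv1 H; inv2 H]>>, on [set: X] | 'P]].

Definition orbits (X : finType) (A : {set {perm X}}) : {set {set X}} :=
  [set orbit 'P <<A>> x | x : X].

Definition vertices (X : finType) (H : flag_system X) : {set {set X}} :=
  orbits [set inv1 H; inv2 H].

Definition edges (X : finType) (H : flag_system X) : {set {set X}} :=
  orbits [set inv0 H; inv2 H].

Definition faces (X : finType) (H : flag_system X) : {set {set X}} :=
  orbits [set inv0 H; inv1 H].

Definition half_edges (X : finType) (H : flag_system X) : {set {set X}} :=
  orbits [set inv2 H].

Definition angles (X : finType) (H : flag_system X) : {set {set X}} :=
  orbits [set inv1 H].

Definition is_map (X : finType) (H : flag_system X) : Prop :=
  is_hypermap H /\ forall e, e \in edges H -> #|e| = 4.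

(* The halving is exact on the hyperedges of a hypermap, because inv0 pairs
   off the flags of a hyperedge. *)
Definition valence (X : finType) (e : {set X}) : nat := #|e|./2.

Definition half_edges_at (X : finType) (H : flag_system X) (v : {set X}) :
  {set {set X}} := [set h in half_edges H | h \subset v].

Definition angles_at (X : finType) (H : flag_system X) (v : {set X}) :
  {set {set X}} := [set a in angles H | a \subset v].

Definition degree (X : finType) (H : flag_system X) (v : {set X}) : nat :=
  #|half_edges_at H v|.

(* The flags of an edge lying on the same side of it are exchanged by inv0,
   whereas inv2 crosses the edge. *)
Definition sides (X : finType) (H : flag_system X) (E : {set X}) :
  {set {set X}} := [set s in orbits [set inv0 H] | s \subset E].

Notation colour := bool (only parsing).
Definition black : colour := true.
Definition white : colour := false.
Definition other (c : colour) : colour := ~~ c.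

Section Medial.
Variables (X : finType) (H : flag_system X).

Definition mu0_fun (y : X * colour) : X * colour := (inv1 H y.1, y.2).

Definition mu1_fun (y : X * colour) : X * colour :=
  (if y.2 == black then inv2 H y.1 else inv0 H y.1, y.2).

Definition mu2_fun (y : X * colour) : X * colour := (y.1, other y.2).

Lemma mu0_inj : injective mu0_fun.
Proof. by case=> x c [x' c'] [/perm_inj -> ->]. Qed.

Lemma mu1_inj : injective mu1_fun.
Proof.
case=> x c [x' c'] [/= + cc]; rewrite -{c'}cc.
by case: ifP => _ /perm_inj ->.
Qed.

Lemma mu2_inj : injective mu2_fun.
Proof. by case=> x c [x' c'] [-> /negb_inj ->]. Qed.

Definition medial : flag_system (X * colour)%type :=
  FlagSystem (perm mu0_inj) (perm mu1_inj) (perm mu2_inj).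

End Medial.

Definition is_coloured (X : finType) (c : colour) (A : {set X * colour}) :
  bool := A \subset setX [set: X] [set c].

Definition faces_of_colour (X : finType) (M : flag_system (X * colour)%type)
  (c : colour) : {set {set X * colour}} :=
  [set F in faces M | is_coloured c F].

Definition angles_of_colour_at (X : finType)
  (M : flag_system (X * colour)%type) (c : colour) (v : {set X * colour}) :
  {set {set X * colour}} := [set a in angles_at M v | is_coloured c a].

Definition both_colours (X : finType) (A : {set X}) : {set X * colour} :=
  setX A [set: colour].

Definition with_colour (X : finType) (c : colour) (A : {set X}) :
  {set X * colour} := setX A [set c].

Definition flag_half_edge (X : finType) (x : X) : {set X * colour} :=
  [set (x, black); (x, white)].

Definition pairs (X : finType) (s : {perm X}) (A : {set X}) :
  {set {set X}} := [set [set x; s x] | x in A].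

Definition set_bijection (T U : finType) (f : T -> U)
  (A : {set T}) (B : {set U}) : Prop :=
  {in A &, injective f} /\ f @: A = B.

(* Main.v *)
Require Import Defs.
From HB Require Import structures.
From mathcomp Require Import all_boot all_fingroup.

(** The medial flag (x, c) carries the flag x of the hypermap and a colour c.
    In the first coordinate, mu0 acts as tau1, mu1 acts as the corner involution
    of the colour c (tau2 if c is black, tau0 if c is white), and mu2 does not
    move it; in the second coordinate, only mu2 acts, by exchanging the colours.

    Every cell of the medial map is an orbit of the group generated by a set of
    mu's, and such orbits are of two kinds. If mu2 is not among the generators,
    the colour is constant along the orbit, so the orbit is one coloured copy of
    an orbit of the hypermap: this covers faces, angles and the sides of edges
    ([orbit_with_colour]). If mu2 is among the generators, the colour can be
    changed at will before another generator is applied, so the orbit is both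
    coloured copies of an orbit of the group generated by all the first
    coordinate actions: this covers vertices, edges and the transitivity of the
    whole group ([orbit_both_colours]). Both statements rest on the description
    of the orbit of x as the least set that contains x and is stable under the
    generators ([orbit_gen_min], [orbit_gen_stable]).

    The correspondences then hold because a set of flags is recovered from its
    coloured copies, and the counts because the involutions have no fixed point:
    {x, tau1 x} has two elements, so that medial edges have four flags, and a
    hyperedge has evenly many flags, so that twice its valence is the number of
    its flags, hence of the half-edges labelled by them. *)

(** * Orbits of generated permutation groups *)

Section GeneratedOrbits.
Local Open Scope group_scope.
Context {X : finType}.
Implicit Types (A : {set {perm X}}) (S e : {set X}) (x y : X) (s : {perm X}).

Lemma orbit_gen_min A x S :
    x \in S -> (forall s y, s \in A -> y \in S -> s y \in S) ->
  orbit 'P <<A>> x \subset S.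
Proof.
move=> Sx stabS; rewrite acts_sub_orbit // gen_subG.
apply/subsetP=> s As; rewrite !inE /=.
by apply/subsetP=> y Sy; rewrite inE; apply: stabS.
Qed.

Lemma orbit_gen_stable A x s y :
  s \in A -> y \in orbit 'P <<A>> x -> s y \in orbit 'P <<A>> x.
Proof.
move=> As; apply: orbit_trans.
by apply/orbitP; exists s => //; apply: mem_gen.
Qed.

Lemma orbits_stable A e s x : e \in orbits A -> s \in A -> x \in e -> s x \in e.
Proof. by case/imsetP=> y _ -> As; apply: orbit_gen_stable. Qed.

Lemma orbit_involution s x : s (s x) = x -> orbit 'P <<[set s]>> x = [set x; s x].
Proof.
move=> ssx; apply/eqP; rewrite eqEsubset; apply/andP; split.
  apply: orbit_gen_min => [|_ y /set1P->]; first by rewrite set21.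
  by case/set2P=> ->; rewrite ?ssx ?set21 ?set22.
apply/subsetP=> y /set2P[]->; first exact: orbit_refl.
by apply: orbit_gen_stable; rewrite ?set11 ?orbit_refl.
Qed.

Lemma orbits_involution s :
  fpf_involution s -> orbits [set s] = pairs s [set: X].
Proof.
move=> sK; apply/setP=> e; apply/imsetP/imsetP=> -[x _ ->]; exists x => //;
  by rewrite orbit_involution //; case: (sK x).
Qed.

(** The pairs {x, s x} with x in e partition e into two-element blocks. *)
Lemma card_stable_even s e :
    fpf_involution s -> (forall x, x \in e -> s x \in e) -> ~~ odd #|e|.
Proof.
move=> sK stab_e.
have partP : partition (pairs s e) e.
  apply/and3P; split.
  - rewrite /cover; apply/eqP/setP=> y; apply/bigcupP/idP=> [[_ /imsetP[x xe ->]]|ye].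
      by case/set2P=> ->; rewrite ?stab_e.
    by exists [set y; s y]; rewrite ?set21 //; apply: imset_f.
  - apply/trivIsetP=> _ _ /imsetP[x _ ->] /imsetP[y _ ->].
    apply: contraR => /pred0Pn[z /andP[]] /=.
    have [sx _] := sK x; have [sy _] := sK y.
    rewrite -(orbit_involution _ _ sx) -(orbit_involution _ _ sy).
    by move=> /orbit_eqP xz /orbit_eqP yz; apply/eqP; apply: etrans (esym xz) yz.
  - by apply/imsetP=> -[x _ /setP/(_ x)]; rewrite set21 inE.
have card2 B : B \in pairs s e -> #|B| = 2.
  by case/imsetP=> x _ ->; rewrite cards2 eq_sym; case: (sK x) => _ ->.
by rewrite (card_uniform_partition card2 partP) oddM andbF.
Qed.

End GeneratedOrbits.

(** * Coloured copies of orbits *)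

Section ColouredCopies.
Local Open Scope group_scope.
Context {X : finType}.
Implicit Types (A : {set X}) (c : colour) (x : X).

Lemma mem_both_colours A x c : ((x, c) \in both_colours A) = (x \in A).
Proof. by rewrite in_setX in_setT andbT. Qed.

Lemma mem_with_colour A x c d :
  ((x, d) \in with_colour c A) = (x \in A) && (d == c).
Proof. by rewrite in_setX in_set1. Qed.

Lemma both_colours_inj : injective (@both_colours X).
Proof.
move=> A B AB; apply/setP=> x.
by rewrite -(mem_both_colours A x black) AB mem_both_colours.
Qed.

Lemma with_colour_inj c : injective (@with_colour X c).
Proof.
move=> A B AB; apply/setP=> x.
by have:= mem_with_colour A x c c; rewrite AB mem_with_colour eqxx !andbT.
Qed.

Lemma card_both_colours A : #|both_colours A| = (#|A| * 2)%N.
Proof. by rewrite cardsX cardsT card_bool. Qed.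

Lemma with_colour_coloured A x c d :
  x \in A -> is_coloured c (with_colour d A) = (d == c).
Proof.
move=> Ax; apply/subsetP/eqP=> [/(_ (x, d))|-> [y k]].
  by rewrite mem_with_colour mem_with_colour Ax eqxx in_setT => /(_ isT)/eqP.
by rewrite !mem_with_colour in_setT => /andP[].
Qed.

Lemma with_colour_sub_both A B c :
  (with_colour c A \subset both_colours B) = (A \subset B).
Proof.
apply/subsetP/subsetP=> [AB x Ax|AB [x d]].
  by rewrite -(mem_both_colours B x c) AB // mem_with_colour Ax /=.
by rewrite mem_with_colour mem_both_colours => /andP[/AB].
Qed.

Lemma proj_with_colour A c : [set y.1 | y in with_colour c A] = A.
Proof.
apply/setP=> x; apply/imsetP/idP=> [[[y d]]|Ax].
  by rewrite mem_with_colour => /andP[Ay _] ->.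
by exists (x, c); rewrite // mem_with_colour Ax /=.
Qed.

Variables (B : {set {perm X}}) (C : {set {perm X * colour}}).

(** The hypotheses say that on the flags of colour c the permutations in C are
    the coloured copies of those in B, hence preserve the colour. *)
Lemma orbit_with_colour c x :
    (forall m, m \in C -> exists2 b, b \in B & forall y, m (y, c) = (b y, c)) ->
    (forall b, b \in B -> exists2 m, m \in C & forall y, m (y, c) = (b y, c)) ->
  orbit 'P <<C>> (x, c) = with_colour c (orbit 'P <<B>> x).
Proof.
move=> CB BC; apply/eqP; rewrite eqEsubset; apply/andP; split.
  apply: orbit_gen_min => [|m [y d] /CB[b Bb mb]].
    by rewrite mem_with_colour orbit_refl /=.
  rewrite mem_with_colour => /andP[xy /eqP->].
  by rewrite mb mem_with_colour orbit_gen_stable /=.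
apply/subsetP=> -[y d]; rewrite mem_with_colour => /andP[xy /eqP->{d}].
have /subsetP/(_ y xy) : orbit 'P <<B>> x \subset
    [set z | (z, c) \in orbit 'P <<C>> (x, c)].
  apply: orbit_gen_min => [|b z /BC[m Cm mb]]; rewrite !inE ?orbit_refl //.
  by rewrite -mb; apply: orbit_gen_stable.
by rewrite inE.
Qed.

(** A generator in B need only be realised by C on one colour, because mu2
    brings a flag to that colour. The reverse inclusion uses the set of flags
    both of whose copies lie in the orbit: it is this set, and not the flags
    with a copy of a given colour in the orbit, which is visibly stable. *)
Lemma orbit_both_colours (mu2 : {perm X * colour}) x c :
    mu2 \in C -> (forall y d, mu2 (y, d) = (y, ~~ d)) ->
    (forall m y d, m \in C ->
       (m (y, d)).1 = y \/ exists2 b, b \in B & (m (y, d)).1 = b y) ->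
    (forall b, b \in B ->
       exists2 m, m \in C & exists d, forall y, m (y, d) = (b y, d)) ->
  orbit 'P <<C>> (x, c) = both_colours (orbit 'P <<B>> x).
Proof.
move=> Cmu2 mu2E CB BC; apply/eqP; rewrite eqEsubset; apply/andP; split.
  apply: orbit_gen_min => [|m [y d] Cm].
    by rewrite mem_both_colours orbit_refl.
  rewrite mem_both_colours => xy; have := CB m y d Cm.
  case: (m (y, d)) => [z k]; rewrite mem_both_colours /=.
  by case=> [->|[b Bb ->]] //; apply: orbit_gen_stable.
have flip z d k :
    (z, d) \in orbit 'P <<C>> (x, c) -> (z, k) \in orbit 'P <<C>> (x, c).
  by case: d k => -[] // /(orbit_gen_stable _ _ _ _ Cmu2); rewrite mu2E.
apply/subsetP=> -[y d]; rewrite mem_both_colours => xy.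
have /subsetP/(_ y xy) : orbit 'P <<B>> x \subset
    [set z | [forall k, (z, k) \in orbit 'P <<C>> (x, c)]].
  apply: orbit_gen_min => [|b z /BC[m Cm [k mb]]]; rewrite !inE.
    by apply/forallP=> k; apply: flip (orbit_refl _ _ _).
  move/forallP/(_ k)/(orbit_gen_stable _ _ _ _ Cm); rewrite mb => Oz.
  by apply/forallP=> k'; apply: flip Oz.
by rewrite inE => /forallP.
Qed.

Lemma both_colours_bijection :
    (forall x c, orbit 'P <<C>> (x, c) = both_colours (orbit 'P <<B>> x)) ->
  set_bijection (@both_colours X) (orbits B) (orbits C).
Proof.
move=> BC; split; first by move=> e e' _ _; apply: both_colours_inj.
apply/setP=> v; apply/imsetP/imsetP=> [[_ /imsetP[x _ ->] ->]|[[x c] _ ->]].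
  by exists (x, black); rewrite ?BC.
by exists (orbit 'P <<B>> x); rewrite ?BC //; apply: imset_f.
Qed.

End ColouredCopies.

(** * The cells of the medial map *)

Section MedialCells.
Local Open Scope group_scope.
Context {X : finType} (H : flag_system X).
Hypothesis hH : is_hypermap H.
Implicit Types (e : {set X}) (c d : colour) (x y : X).

(** The involution of the hypermap that mu1 follows on the flags of colour c.
    Together with tau1 it generates the vertices of the hypermap if c is black
    and its faces if c is white, so that both colours are treated at once. *)
Definition corner c : {perm X} := if c == black then inv2 H else inv0 H.

Lemma medial0E x c : inv0 (medial H) (x, c) = (inv1 H x, c).
Proof. by rewrite permE. Qed.

Lemma medial1E x c : inv1 (medial H) (x, c) = (corner c x, c).
Proof. by rewrite permE /mu1_fun /corner /=; case: ifP. Qed.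

Lemma medial2E x c : inv2 (medial H) (x, c) = (x, ~~ c).
Proof. by rewrite permE. Qed.

Lemma inv1_fpf : fpf_involution (inv1 H).
Proof. by case: hH. Qed.

Lemma corner_fpf c : fpf_involution (corner c).
Proof. by case: hH => s0 _ s2 _; rewrite /corner; case: ifP. Qed.

Lemma corner_edge_gen c : corner c \in [set inv0 H; inv2 H].
Proof. by rewrite /corner; case: ifP; rewrite ?set21 ?set22. Qed.

Lemma medial0_fpf : fpf_involution (inv0 (medial H)).
Proof.
case=> x c; have [sx nx] := inv1_fpf x; rewrite !medial0E sx; split=> //.
by rewrite xpair_eqE negb_and nx.
Qed.

Lemma medial1_fpf : fpf_involution (inv1 (medial H)).
Proof.
case=> x c; have [sx nx] := corner_fpf c x; rewrite !medial1E sx; split=> //.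
by rewrite xpair_eqE negb_and nx.
Qed.

Lemma medial2_fpf : fpf_involution (inv2 (medial H)).
Proof.
case=> x c; rewrite !medial2E negbK; split=> //.
by rewrite xpair_eqE negb_and; case: c; rewrite orbT.
Qed.

Lemma medial_vertexE x c :
  orbit 'P <<[set inv1 (medial H); inv2 (medial H)]>> (x, c)
  = both_colours (orbit 'P <<[set inv0 H; inv2 H]>> x).
Proof.
apply: (@orbit_both_colours _ _ _ (inv2 (medial H))); rewrite ?set22 //.
- exact: medial2E.
- move=> _ y d /set2P[]->; last by left; rewrite medial2E.
  by right; exists (corner d); [apply: corner_edge_gen | rewrite medial1E].
- move=> _ /set2P[]->; exists (inv1 (medial H)); rewrite ?set21 //.
    by exists white => y; rewrite medial1E.
  by exists black => y; rewrite medial1E.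
Qed.

Lemma medial_edgeE x c :
  orbit 'P <<[set inv0 (medial H); inv2 (medial H)]>> (x, c)
  = both_colours (orbit 'P <<[set inv1 H]>> x).
Proof.
apply: (@orbit_both_colours _ _ _ (inv2 (medial H))); rewrite ?set22 //.
- exact: medial2E.
- move=> _ y d /set2P[]->; last by left; rewrite medial2E.
  by right; exists (inv1 H); [apply: set11 | rewrite medial0E].
- move=> _ /set1P->; exists (inv0 (medial H)); first exact: set21.
  by exists black => y; rewrite medial0E.
Qed.

Lemma medial_componentE x c :
  orbit 'P <<[set inv0 (medial H); inv1 (medial H); inv2 (medial H)]>> (x, c)
  = both_colours (orbit 'P <<[set inv0 H; inv1 H; inv2 H]>> x).
Proof.
apply: (@orbit_both_colours _ _ _ (inv2 (medial H))).
- by rewrite !inE eqxx !orbT.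
- exact: medial2E.
- move=> _ y d /setUP[/set2P[]|/set1P]->; last by left; rewrite medial2E.
    by right; exists (inv1 H); rewrite ?medial0E // !inE eqxx !orbT.
  right; exists (corner d); rewrite ?medial1E // !inE.
  by case/set2P: (corner_edge_gen d) => ->; rewrite eqxx ?orbT.
- move=> _ /setUP[/set2P[]|/set1P]->.
  + exists (inv1 (medial H)); first by rewrite !inE eqxx !orbT.
    by exists white => y; rewrite medial1E.
  + exists (inv0 (medial H)); first by rewrite !inE eqxx.
    by exists black => y; rewrite medial0E.
  + exists (inv1 (medial H)); first by rewrite !inE eqxx !orbT.
    by exists black => y; rewrite medial1E.
Qed.

Lemma medial_faceE x c :
  orbit 'P <<[set inv0 (medial H); inv1 (medial H)]>> (x, c)
  = with_colour c (orbit 'P <<[set inv1 H; corner c]>> x).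
Proof.
apply: orbit_with_colour => _ /set2P[]->.
- by exists (inv1 H); [apply: set21 | move=> y; rewrite medial0E].
- by exists (corner c); [apply: set22 | move=> y; rewrite medial1E].
- by exists (inv0 (medial H)); [apply: set21 | move=> y; rewrite medial0E].
- by exists (inv1 (medial H)); [apply: set22 | move=> y; rewrite medial1E].
Qed.

Lemma medial_sideE x c :
  orbit 'P <<[set inv0 (medial H)]>> (x, c)
  = with_colour c (orbit 'P <<[set inv1 H]>> x).
Proof.
apply: orbit_with_colour => _ /set1P->.
- by exists (inv1 H); [apply: set11 | move=> y; rewrite medial0E].
- by exists (inv0 (medial H)); [apply: set11 | move=> y; rewrite medial0E].
Qed.

Lemma medial_angleE x c :
  orbit 'P <<[set inv1 (medial H)]>> (x, c) = with_colour c [set x; corner c x].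
Proof.
rewrite -orbit_involution; last by case: (corner_fpf c x).
apply: orbit_with_colour => _ /set1P->.
- by exists (corner c); [apply: set11 | move=> y; rewrite medial1E].
- by exists (inv1 (medial H)); [apply: set11 | move=> y; rewrite medial1E].
Qed.

Lemma medial_half_edgeE x c :
  orbit 'P <<[set inv2 (medial H)]>> (x, c) = flag_half_edge x.
Proof.
rewrite orbit_involution; last by case: (medial2_fpf (x, c)).
by rewrite medial2E; case: c; rewrite // setUC.
Qed.

(** * The correspondence of cells *)

Lemma medial_is_map : is_map (medial H).
Proof.
split; last first.
  move=> _ /imsetP[[x c] _ ->]; have [sx nx] := inv1_fpf x.
  by rewrite medial_edgeE card_both_colours orbit_involution // cards2 eq_sym nx.
split; [exact: medial0_fpf | exact: medial1_fpf | exact: medial2_fpf |].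
have [_ _ _ /imsetP[x _ Xx]] := hH.
apply/imsetP; exists (x, black) => //.
rewrite medial_componentE -Xx.
by apply/setP=> -[y c]; rewrite mem_both_colours !in_setT.
Qed.

Lemma vertex_bijection :
  set_bijection (@both_colours X) (edges H) (vertices (medial H)).
Proof. exact/both_colours_bijection/medial_vertexE. Qed.

Lemma edge_bijection :
  set_bijection (@both_colours X) (pairs (inv1 H) [set: X]) (edges (medial H)).
Proof.
rewrite -orbits_involution; last exact: inv1_fpf.
exact/both_colours_bijection/medial_edgeE.
Qed.

Lemma mem_flag_half_edge x y c : ((y, c) \in flag_half_edge x) = (y == x).
Proof. by rewrite !inE !xpair_eqE -andb_orr; case: c; rewrite andbT. Qed.

Lemma flag_half_edge_inj : injective (@flag_half_edge X).
Proof.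
move=> x x' xx'; apply/eqP.
by rewrite -(mem_flag_half_edge x' x black) -xx' mem_flag_half_edge.
Qed.

Lemma half_edge_bijection :
  set_bijection (@flag_half_edge X) [set: X] (half_edges (medial H)).
Proof.
split; first by move=> x x' _ _; apply: flag_half_edge_inj.
apply/setP=> h; apply/imsetP/imsetP=> [[x _ ->]|[[x c] _ ->]].
  by exists (x, black); rewrite ?medial_half_edgeE.
by exists x; rewrite ?medial_half_edgeE.
Qed.

Lemma half_edges_at_both_colours e :
  half_edges_at (medial H) (both_colours e) = [set flag_half_edge x | x in e].
Proof.
have sub_e x : (flag_half_edge x \subset both_colours e) = (x \in e).
  by rewrite subUset !sub1set !mem_both_colours andbb.
have [_ imE] := half_edge_bijection.
apply/setP=> h; rewrite inE -imE; apply/andP/imsetP=> [[]|[x xe ->]].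
  by case/imsetP=> x _ ->; rewrite sub_e; exists x.
by rewrite sub_e; split=> //; apply: imset_f.
Qed.

Lemma degree_both_colours e :
  e \in edges H -> degree (medial H) (both_colours e) = (2 * valence e)%N.
Proof.
move=> He; rewrite /degree half_edges_at_both_colours.
rewrite card_imset; last exact: flag_half_edge_inj.
have even_e : ~~ odd #|e|.
  apply: (card_stable_even (inv0 H)); first by case: hH.
  by move=> x; apply: orbits_stable He _; rewrite set21.
by rewrite /valence mul2n even_halfK.
Qed.

Lemma medial_face_coloured x c d :
  is_coloured d (orbit 'P <<[set inv0 (medial H); inv1 (medial H)]>> (x, c))
  = (c == d).
Proof. by rewrite medial_faceE (with_colour_coloured _ x) ?orbit_refl. Qed.

Lemma face_bijection c :
  set_bijection (@with_colour X c) (orbits [set inv1 H; corner c])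
    (faces_of_colour (medial H) c).
Proof.
split; first by move=> u u' _ _; apply: with_colour_inj.
apply/setP=> F; rewrite [RHS]inE.
apply/imsetP/andP=> [[_ /imsetP[x _ ->] ->]|[/imsetP[[x d] _ ->]]].
  by rewrite -medial_faceE medial_face_coloured; split=> //; apply: imset_f.
rewrite medial_face_coloured => /eqP->.
by exists (orbit 'P <<[set inv1 H; corner c]>> x);
  [apply: imset_f | apply: medial_faceE].
Qed.

Lemma proj_angles_of_colour e c :
    e \in edges H ->
  [set [set y.1 | y in a]
     | a : {set X * colour}
       in angles_of_colour_at (medial H) c (both_colours e)]
  = pairs (corner c) e.
Proof.
move=> He; apply/setP=> p; apply/imsetP/imsetP=> [[a]|[x xe ->]].
  rewrite 2!inE => /andP[/andP[/imsetP[[x d] _ ->]]].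
  rewrite medial_angleE (with_colour_coloured _ x) ?set21 //.
  rewrite with_colour_sub_both subUset !sub1set proj_with_colour.
  by case/andP=> xe _ /eqP-> ->; exists x.
exists (with_colour c [set x; corner c x]); last by rewrite proj_with_colour.
rewrite 2!inE (with_colour_coloured _ x) ?set21 // eqxx andbT.
rewrite with_colour_sub_both subUset !sub1set xe.
rewrite (orbits_stable _ _ _ _ He) ?corner_edge_gen //.
by rewrite !andbT -medial_angleE; apply: imset_f.
Qed.

Lemma medial_face_one_colour F :
  F \in faces (medial H) -> is_coloured black F (+) is_coloured white F.
Proof.
by case/imsetP=> -[x c] _ ->; rewrite !medial_face_coloured; case: c.
Qed.

(** A side of the edge through x is a coloured copy of {x, tau1 x}; the side
    through another flag y of that pair is the same one, as {y, tau1 y} is the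
    same orbit. *)
Lemma medial_sides x :
  sides (medial H) (both_colours (orbit 'P <<[set inv1 H]>> x))
  = [set with_colour c (orbit 'P <<[set inv1 H]>> x) | c : colour].
Proof.
apply/setP=> s; rewrite inE; apply/andP/imsetP=> [[]|[c _ ->]].
  case/imsetP=> -[y c] _ ->; rewrite medial_sideE with_colour_sub_both.
  move/subsetP/(_ y (orbit_refl _ _ _)) => /orbit_eqP->.
  by exists c.
by rewrite with_colour_sub_both -medial_sideE; split=> //; apply: imset_f.
Qed.

Lemma medial_edge_sides E :
    E \in edges (medial H) ->
  exists s s' F F' : {set X * colour},
    [/\ s != s', sides (medial H) E = [set s; s'],
        F \in faces_of_colour (medial H) black /\ s \subset F
      & F' \in faces_of_colour (medial H) white /\ s' \subset F'].
Proof.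
case/imsetP=> -[x c0] _ ->; rewrite medial_edgeE medial_sides.
pose p := orbit 'P <<[set inv1 H]>> x.
pose side c := with_colour c p.
pose face c := with_colour c (orbit 'P <<[set inv1 H; corner c]>> x).
have face_c c : face c \in faces_of_colour (medial H) c /\ side c \subset face c.
  split.
    by have [_ <-] := face_bijection c; apply: imset_f; apply: imset_f.
  apply: setXS => //; apply: orbit_gen_min => [|_ y /set1P->].
    exact: orbit_refl.
  by apply: orbit_gen_stable; rewrite set21.
exists (side black), (side white), (face black), (face white).
split=> //.
- apply/eqP=> /setP/(_ (x, black)).
  by rewrite !mem_with_colour orbit_refl.
- apply/setP=> s; apply/imsetP/set2P=> [[[] _ ->]|[]->]; [by left | by right | |].
    by exists black.
  by exists white.
Qed.

End MedialCells.

Theorem proposition3p5 (X : finType) (H : flag_system X)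
    (hH : is_hypermap H) :
  is_map (medial H)
  /\
  set_bijection (@both_colours X) (edges H) (vertices (medial H))
  /\
  (set_bijection (@flag_half_edge X) [set: X] (half_edges (medial H)) /\
   (forall e : {set X}, e \in edges H ->
      half_edges_at (medial H) (both_colours e)
      = [set flag_half_edge x | x in e]))
  /\
  set_bijection (@both_colours X) (pairs (inv1 H) [set: X])
    (edges (medial H))
  /\
  set_bijection (@with_colour X black) (vertices H)
    (faces_of_colour (medial H) black)
  /\
  set_bijection (@with_colour X white) (faces H)
    (faces_of_colour (medial H) white)
  /\
  (forall (e : {set X}) (k : nat), e \in edges H -> valence e = k ->
     degree (medial H) (both_colours e) = 2 * k)
  /\
  (forall e : {set X}, e \in edges H ->
     [set [set y.1 | y in a]
        | a : {set X * colour}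
          in angles_of_colour_at (medial H) black (both_colours e)]
     = pairs (inv2 H) e
     /\
     [set [set y.1 | y in a]
        | a : {set X * colour}
          in angles_of_colour_at (medial H) white (both_colours e)]
     = pairs (inv0 H) e)
  /\
  ((forall F : {set X * colour}, F \in faces (medial H) ->
      is_coloured black F (+) is_coloured white F) /\
   (forall E : {set X * colour}, E \in edges (medial H) ->
      exists s s' F F' : {set X * colour},
        [/\ s != s', sides (medial H) E = [set s; s'],
            F \in faces_of_colour (medial H) black /\ s \subset F
          & F' \in faces_of_colour (medial H) white /\ s' \subset F'])).
Proof.
split; first exact: medial_is_map.
split; first exact: vertex_bijection.
split.
  split; first exact: half_edge_bijection.
  by move=> e _; apply: half_edges_at_both_colours.
split; first exact: edge_bijection.
split; first exact: (face_bijection H black).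
split; first by rewrite /faces /orbits setUC; apply: (face_bijection H white).
split; first by move=> e k He <-; apply: degree_both_colours.
split; last by split; [apply: medial_face_one_colour | apply: medial_edge_sides].
by move=> e He; split; [apply: (proj_angles_of_colour H hH e black)
                      | apply: (proj_angles_of_colour H hH e white)].
Qed.
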